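(* Let $\varphi$ satisfy conditions (1)–(5) and let $\psi$ be as defined below. Let $D\subset\mathbb R^n$, $n\ge2$, be a bounded domain. If $D$ is a $\psi$-John domain, then $D$ is a $\varphi$-cigar John domain. Conversely, if $D$ is a $\varphi$-cigar John domain with constant $c_J$, then $D$ is a $\psi$-John domain with constants $$\alpha=\frac{c_J\,\varphi(1)\left(\max\left\{2,\frac{c_J\operatorname{diam}(D)}{\varphi(1)}\right\}\right)^2}{\psi\!\left(\frac1{2c_J}\psi\!\left(\frac14\operatorname{diam}(D)\right)\right)},\qquad \beta=\max\left\{2,\frac{c_J\operatorname{diam}(D)}{\varphi(1)}\right\}.$$
   Context: Conditions on $\varphi:[0,\infty)\to[0,\infty)$: (1) continuous; (2) strictly increasing; (3) $\varphi(0)=\lim_{t\to0^+}\varphi(t)=0$; (4) there is $C_\varphi\ge1$ with $\varphi(t_1)/t_1\le C_\varphi\,\varphi(t_2)/t_2$ whenever $0<t_1\le t_2$; (5) there is $C^{\Delta_2}_\varphi\ge1$ with $\varphi(2t)\le C^{\Delta_2}_\varphi\varphi(t)$ for all $t>0$. Define $\psi(t)=\varphi(t)$ for $0\le t\le1$, $\psi(t)=\varphi(1)t$ for $t\ge1$. $\varphi$-cigar John domain: a (bounded or unbounded) domain $D\subset\mathbb R^n$ is a $\varphi$-cigar John domain with constant $c_J>0$ if every pair of points $a,b\in D$ can be joined by a rectifiable arc $E\subset D$ with endpoints $a,b$ such that $\bigcup\{B(x,\psi(q(x))/c_J):x\in E\setminus\{a,b\}\}\subset D$, where for $x\in E$,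 $q(x)=\min\{\ell(E[a,x]),\ell(E[x,b])\}$, $E[x,y]$ denotes the subarc between $x$ and $y$ and $\ell$ denotes length. $\psi$-John domain: a bounded domain $D\subset\mathbb R^n$ is a $\psi$-John domain with constants $\alpha,\beta\in(0,\infty)$ if there is a point $x_0\in D$ such that each $x\in D$ can be joined to $x_0$ by a rectifiable curve $\gamma:[0,\ell(\gamma)]\to D$ parametrized by arc length with $\gamma(0)=x$, $\gamma(\ell(\gamma))=x_0$, $\ell(\gamma)\le\beta$, and $\psi(t)\le\frac{\alpha}{\ell(\gamma)}\operatorname{dist}(\gamma(t),\partial D)$ for all $t\in[0,\ell(\gamma)]$. *)

(* Defs.v *)
From Stdlib Require Import Reals Lra List.
Open Scope R_scope.

(* Points of R^n are represented as functions nat -> R that vanish at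
   every index >= n. *)
Definition point := nat -> R.
Definition inRn (n : nat) (x : point) : Prop := forall i, (n <= i)%nat -> x i = 0.

Fixpoint rsum (f : nat -> R) (k : nat) : R :=
  match k with O => 0 | S k' => rsum f k' + f k' end.

Definition dist (n : nat) (x y : point) : R :=
  sqrt (rsum (fun i => (x i - y i) ^ 2) n).

Definition norm (n : nat) (x : point) : R := dist n x (fun _ => 0).

Definition open_set (n : nat) (U : point -> Prop) : Prop :=
  forall x, U x -> exists r, 0 < r /\ forall y, inRn n y -> dist n x y < r -> U y.

Definition connected_set (n : nat) (D : point -> Prop) : Prop :=
  forall U V : point -> Prop, open_set n U -> open_set n V ->
    (forall x, D x -> U x \/ V x) ->
    (forall x, D x -> U x -> V x -> False) ->
    (exists x, D x /\ U x) -> (exists x, D x /\ V x) -> False.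

Definition domain (n : nat) (D : point -> Prop) : Prop :=
  (forall x, D x -> inRn n x) /\ (exists x, D x) /\ open_set n D /\ connected_set n D.

Definition bounded_set (n : nat) (D : point -> Prop) : Prop :=
  exists M, forall x, D x -> norm n x <= M.

Definition is_diam (n : nat) (D : point -> Prop) (d : R) : Prop :=
  is_lub (fun r => exists x y, D x /\ D y /\ r = dist n x y) d.

Definition boundary (n : nat) (D : point -> Prop) (z : point) : Prop :=
  inRn n z /\
  forall eps, 0 < eps ->
    (exists w, D w /\ dist n z w < eps) /\
    (exists w, inRn n w /\ ~ D w /\ dist n z w < eps).

Definition curve_cont (n : nat) (g : R -> point) (a b : R) : Prop :=
  forall t, a <= t <= b -> forall eps, 0 < eps -> exists del, 0 < del /\
    forall s, a <= s <= b -> Rabs (s - t) < del -> dist n (g s) (g t) < eps.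

Fixpoint chain_sum (n : nat) (g : R -> point) (x : R) (l : list R) : R :=
  match l with nil => 0 | y :: l' => dist n (g x) (g y) + chain_sum n g y l' end.

Fixpoint nondecr (x : R) (l : list R) : Prop :=
  match l with nil => True | y :: l' => x <= y /\ nondecr y l' end.

Definition partition (s t : R) (l : list R) : Prop :=
  nondecr s l /\ last l s = t.

Definition curve_length (n : nat) (g : R -> point) (s t L : R) : Prop :=
  is_lub (fun r => exists l, partition s t l /\ r = chain_sum n g s l) L.

Definition phi_conditions (phi : R -> R) : Prop :=
  (forall t, 0 <= t -> 0 <= phi t) /\
  (forall t, 0 <= t -> forall eps, 0 < eps -> exists del, 0 < del /\
     forall s, 0 <= s -> Rabs (s - t) < del -> Rabs (phi s - phi t) < eps) /\
  (forall s t, 0 <= s -> s < t -> phi s < phi t) /\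
  phi 0 = 0 /\
  (exists C, 1 <= C /\ forall t1 t2, 0 < t1 -> t1 <= t2 -> phi t1 / t1 <= C * (phi t2 / t2)) /\
  (exists C, 1 <= C /\ forall t, 0 < t -> phi (2 * t) <= C * phi t).

Definition psi (phi : R -> R) (t : R) : R :=
  if Rle_dec t 1 then phi t else phi 1 * t.

Definition cigar_john (n : nat) (phi : R -> R) (D : point -> Prop) (cJ : R) : Prop :=
  0 < cJ /\
  forall a b, D a -> D b -> a <> b ->
    exists g : R -> point,
      curve_cont n g 0 1 /\
      (forall s t, 0 <= s <= 1 -> 0 <= t <= 1 -> g s = g t -> s = t) /\
      g 0 = a /\ g 1 = b /\
      (forall t, 0 <= t <= 1 -> D (g t)) /\
      (exists L, curve_length n g 0 1 L) /\
      (forall t, 0 < t < 1 -> forall L1 L2,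
         curve_length n g 0 t L1 -> curve_length n g t 1 L2 ->
         forall y, inRn n y -> dist n (g t) y < psi phi (Rmin L1 L2) / cJ -> D y).

(* psi-John domain with constants alpha, beta.  The condition
   psi(t) <= alpha/l * dist(g t, bdry D) is written out pointwise over
   boundary points (c <= inf S  iff  c <= every element of S). *)
Definition psi_john (n : nat) (phi : R -> R) (D : point -> Prop) (alpha beta : R) : Prop :=
  0 < alpha /\ 0 < beta /\
  exists x0, D x0 /\
  forall x, D x ->
    exists (g : R -> point) (l : R),
      0 <= l /\
      curve_cont n g 0 l /\
      (forall s t, 0 <= s -> s <= t -> t <= l -> curve_length n g s t (t - s)) /\
      g 0 = x /\ g l = x0 /\
      (forall t, 0 <= t <= l -> D (g t)) /\
      l <= beta /\
      (forall t, 0 <= t <= l -> forall z, boundary n D z ->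
         psi phi t <= alpha / l * dist n (g t) z).

(* Main.v *)
From Stdlib Require Import Reals Lra Lia List Classical ClassicalEpsilon FunctionalExtensionality.
Require Import Defs.
Open Scope R_scope.

(** From John curves to cigars, join the John curves of the two points at the
    centre [x0] and erase loops.  Since distances to the boundary are uniformly
    positive along the joined curve, a sufficiently fine inscribed polygon may
    replace it, and for a polygon loop erasure is a finite induction: truncate
    at the first hit of the next segment.

    From cigars to John curves, take for [x0] the midpoint of an arc joining two
    points more than [diam D / 2] apart; a ball of radius
    [2 rho = psi(diam D / 4) / cJ] about [x0] lies in [D].  The explicit [alpha]
    works thanks to [psi rho <= cJ rho]: indeed [psi q <= cJ q] for
    [q < diam D / 2], because an arc starting next to the boundary and ending far
    away is, after length [q], within about [q] of the boundary. *)

(** * The Euclidean metric *)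

Lemma rsum_ext f g k : (forall i, (i < k)%nat -> f i = g i) -> rsum f k = rsum g k.
Proof.
  induction k as [|k IH]; simpl; intros H; [reflexivity|].
  rewrite IH, H by auto with arith; reflexivity.
Qed.

Lemma rsum_nonneg f k : (forall i, 0 <= f i) -> 0 <= rsum f k.
Proof.
  intros H; induction k as [|k IH]; simpl; [lra|].
  specialize (H k); lra.
Qed.

Lemma rsum_scal c f k : rsum (fun i => c * f i) k = c * rsum f k.
Proof. induction k as [|k IH]; simpl; [ring|rewrite IH; ring]. Qed.

Lemma rsum_first f k : rsum f (S k) = f O + rsum (fun i => f (S i)) k.
Proof.
  induction k as [|k IH]; [simpl; ring|].
  change (rsum f (S k) + f (S k) = f O + (rsum (fun i => f (S i)) k + f (S k))).
  rewrite IH; ring.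
Qed.

Lemma rsum_eq0 f k i : (forall j, 0 <= f j) -> rsum f k = 0 -> (i < k)%nat -> f i = 0.
Proof.
  intros Hf; induction k as [|k IH]; simpl; intros H Hi; [lia|].
  pose proof (rsum_nonneg f k Hf); pose proof (Hf k).
  destruct (Nat.eq_dec i k) as [->|Hne]; [lra|].
  apply IH; [lra|lia].
Qed.

Lemma cauchy_schwarz u v k :
  (rsum (fun i => u i * v i) k) ^ 2 <=
  rsum (fun i => u i ^ 2) k * rsum (fun i => v i ^ 2) k.
Proof.
  induction k as [|k IH]; cbn [rsum]; [lra|].
  assert (HA : 0 <= rsum (fun i => u i ^ 2) k) by (apply rsum_nonneg; intros; apply pow2_ge_0).
  assert (HB : 0 <= rsum (fun i => v i ^ 2) k) by (apply rsum_nonneg; intros; apply pow2_ge_0).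
  revert IH HA HB.
  generalize (rsum (fun i => u i * v i) k) (rsum (fun i => u i ^ 2) k)
    (rsum (fun i => v i ^ 2) k) (u k) (v k).
  intros s A B a b IH HA HB.
  assert (HY : 0 <= A * b ^ 2 + B * a ^ 2).
  { pose proof (pow2_ge_0 a); pose proof (pow2_ge_0 b); nra. }
  assert (Hsq : (2 * s * a * b) ^ 2 <= (A * b ^ 2 + B * a ^ 2) ^ 2).
  { pose proof (pow2_ge_0 (A * b ^ 2 - B * a ^ 2)).
    pose proof (pow2_ge_0 (a * b)).
    assert (s ^ 2 * (a * b) ^ 2 <= A * B * (a * b) ^ 2) by (apply Rmult_le_compat_r; lra).
    nra. }
  assert (2 * s * a * b <= A * b ^ 2 + B * a ^ 2).
  { apply Rnot_lt_le; intros Hlt.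
    assert ((A * b ^ 2 + B * a ^ 2) ^ 2 < (2 * s * a * b) ^ 2) by nra.
    lra. }
  nra.
Qed.

Lemma sqrdist_nonneg n (x y : point) : 0 <= rsum (fun i => (x i - y i) ^ 2) n.
Proof. apply rsum_nonneg; intros; apply pow2_ge_0. Qed.

Lemma dist_nonneg n x y : 0 <= dist n x y.
Proof. apply sqrt_pos. Qed.

Lemma dist_sym n x y : dist n x y = dist n y x.
Proof. unfold dist; f_equal; apply rsum_ext; intros; ring. Qed.

Lemma dist_refl n x : dist n x x = 0.
Proof.
  unfold dist; rewrite (rsum_ext _ (fun i => 0 * 0)) by (intros; ring).
  rewrite rsum_scal, Rmult_0_l; apply sqrt_0.
Qed.

Lemma dist_triangle n x y z : dist n x z <= dist n x y + dist n y z.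
Proof.
  unfold dist.
  set (u := fun i => x i - y i); set (v := fun i => y i - z i).
  change (rsum (fun i => (x i - y i) ^ 2) n) with (rsum (fun i => u i ^ 2) n).
  change (rsum (fun i => (y i - z i) ^ 2) n) with (rsum (fun i => v i ^ 2) n).
  pose proof (cauchy_schwarz u v n) as HCS.
  assert (Hexp : rsum (fun i => (x i - z i) ^ 2) n =
    rsum (fun i => u i ^ 2) n + 2 * rsum (fun i => u i * v i) n + rsum (fun i => v i ^ 2) n).
  { unfold u, v; induction n as [|n IH]; cbn [rsum]; [ring|].
    rewrite IH; [ring|apply cauchy_schwarz]. }
  rewrite Hexp; revert HCS.
  assert (HA : 0 <= rsum (fun i => u i ^ 2) n) by (apply rsum_nonneg; intros; apply pow2_ge_0).
  assert (HB : 0 <= rsum (fun i => v i ^ 2) n) by (apply rsum_nonneg; intros; apply pow2_ge_0).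
  revert HA HB.
  generalize (rsum (fun i => u i * v i) n) (rsum (fun i => u i ^ 2) n)
    (rsum (fun i => v i ^ 2) n).
  intros s A B HA HB HCS.
  pose proof (sqrt_pos A) as HsA; pose proof (sqrt_pos B) as HsB.
  pose proof (sqrt_sqrt A HA) as EA; pose proof (sqrt_sqrt B HB) as EB.
  assert (Hs : s <= sqrt A * sqrt B).
  { apply Rnot_lt_le; intros Hlt.
    assert (0 <= sqrt A * sqrt B) by nra.
    assert ((sqrt A * sqrt B) ^ 2 = A * B) by (rewrite <- EA, <- EB at 2; ring).
    nra. }
  rewrite <- (sqrt_square (sqrt A + sqrt B)) by lra.
  apply sqrt_le_1_alt; nra.
Qed.

Lemma dist_eq0 n x y : inRn n x -> inRn n y -> dist n x y = 0 -> x = y.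
Proof.
  intros Hx Hy H; apply functional_extensionality; intros i.
  destruct (Nat.lt_ge_cases i n) as [Hi|Hi]; [|rewrite Hx, Hy; auto].
  apply sqrt_eq_0 in H; [|apply sqrdist_nonneg].
  apply (rsum_eq0 _ _ i) in H; auto; [|intros; apply pow2_ge_0].
  assert (x i - y i = 0) by nra; lra.
Qed.

Lemma dist_pos n x y : inRn n x -> inRn n y -> x <> y -> 0 < dist n x y.
Proof.
  intros Hx Hy Hne; pose proof (dist_nonneg n x y).
  destruct (Req_dec (dist n x y) 0) as [E|E]; [|lra].
  elim Hne; eapply dist_eq0; eauto.
Qed.

Definition seg (p q : point) (c : R) : point := fun i => p i + c * (q i - p i).

Lemma seg_0 p q : seg p q 0 = p.
Proof. apply functional_extensionality; intros; unfold seg; ring. Qed.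

Lemma seg_1 p q : seg p q 1 = q.
Proof. apply functional_extensionality; intros; unfold seg; ring. Qed.

Lemma inRn_seg n p q c : inRn n p -> inRn n q -> inRn n (seg p q c).
Proof. intros Hp Hq i Hi; unfold seg; rewrite Hp, Hq by assumption; ring. Qed.

Lemma dist_seg n p q c c' : dist n (seg p q c) (seg p q c') = Rabs (c - c') * dist n p q.
Proof.
  unfold dist, seg.
  rewrite (rsum_ext _ (fun i => (c - c') ^ 2 * (p i - q i) ^ 2)) by (intros; ring).
  rewrite rsum_scal, sqrt_mult by (apply pow2_ge_0 || apply sqrdist_nonneg).
  f_equal; rewrite <- (sqrt_Rsqr_abs (c - c')); f_equal; unfold Rsqr; ring.
Qed.

Definition shift (p : point) (s : R) : point :=
  fun i => match i with O => p O + s | S _ => p i end.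

Lemma inRn_shift n p s : (1 <= n)%nat -> inRn n p -> inRn n (shift p s).
Proof. intros Hn Hp [|i] Hi; [lia|simpl; auto]. Qed.

Lemma dist_shift n p s s' : (1 <= n)%nat -> dist n (shift p s) (shift p s') = Rabs (s - s').
Proof.
  destruct n as [|n]; intros Hn; [lia|].
  unfold dist; rewrite rsum_first; cbn [shift].
  rewrite (rsum_ext _ (fun i => 0 * 0)) by (intros; ring).
  rewrite rsum_scal, <- (sqrt_Rsqr_abs (s - s')); f_equal; unfold Rsqr; ring.
Qed.

Lemma shift_0 p : shift p 0 = p.
Proof. apply functional_extensionality; intros [|i]; simpl; ring. Qed.

Definition ball_in (n : nat) (D : point -> Prop) (p : point) (e : R) : Prop :=
  forall y, inRn n y -> dist n p y < e -> D y.

Lemma ball_in_le n D p e e' : e' <= e -> ball_in n D p e -> ball_in n D p e'.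
Proof. intros He H y Hy Hd; apply H; [assumption|lra]. Qed.

Lemma ball_in_shrink n D p q e e' :
  dist n p q + e' <= e -> ball_in n D p e -> ball_in n D q e'.
Proof.
  intros He H y Hy Hd; apply H; [assumption|].
  pose proof (dist_triangle n p q y); lra.
Qed.

Lemma ball_in_boundary n D p e z : ball_in n D p e -> boundary n D z -> e <= dist n p z.
Proof.
  intros H [Hz Hb]; apply Rnot_lt_le; intros Hlt.
  destruct (Hb (e - dist n p z)) as [_ (w & Hw & HDw & Hd)]; [lra|].
  apply HDw, H; [assumption|].
  pose proof (dist_triangle n p z w); lra.
Qed.

Lemma boundary_on_segment n D p y :
  inRn n p -> inRn n y -> D p -> ~ D y ->
  exists z, boundary n D z /\ dist n p z <= dist n p y.
Proof.
  intros Hp Hy HDp HDy.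
  set (E := fun c => 0 <= c <= 1 /\ D (seg p y c)).
  assert (HE0 : E 0) by (split; [lra|rewrite seg_0; assumption]).
  destruct (completeness E) as [c [Hub Hlub]].
  { exists 1; intros x [Hx _]; lra. }
  { exists 0; exact HE0. }
  assert (Hc0 : 0 <= c) by (apply Hub, HE0).
  assert (Hc1 : c <= 1) by (apply Hlub; intros x [Hx _]; lra).
  pose proof (dist_nonneg n p y) as Hpy.
  exists (seg p y c); split.
  - split; [apply inRn_seg; assumption|]. intros eps Heps.
    set (del := eps / (dist n p y + 1)).
    assert (Hdel : 0 < del) by (apply Rdiv_lt_0_compat; lra).
    assert (Hsm : forall c', Rabs (c - c') < del -> dist n (seg p y c) (seg p y c') < eps).
    { intros c' Hc'; rewrite dist_seg.
      assert (E1 : eps = del * (dist n p y + 1)) by (unfold del; field; lra).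
      rewrite E1; pose proof (Rabs_pos (c - c')); nra. }
    split.
    + assert (Hex : exists c', E c' /\ c - del < c').
      { apply NNPP; intros Hno.
        assert (c <= c - del); [|lra].
        apply Hlub; intros x Hx; apply Rnot_lt_le; intros Hlt.
        apply Hno; exists x; auto. }
      destruct Hex as (c' & Hc' & Hlt).
      exists (seg p y c'); split; [apply Hc'|].
      apply Hsm; apply Hub in Hc'; apply Rabs_def1; lra.
    + destruct (Rlt_dec c 1) as [Hlt|Hge].
      * set (c' := Rmin 1 (c + del / 2)).
        assert (c < c' <= 1 /\ c' < c + del).
        { unfold c', Rmin; destruct (Rle_dec 1 (c + del / 2)); lra. }
        exists (seg p y c'); split; [apply inRn_seg; assumption|split].
        -- intros HD; assert (Hle : c' <= c) by (apply Hub; split; [lra|exact HD]); lra.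
        -- apply Hsm, Rabs_def1; lra.
      * exists y; split; [assumption|split; [assumption|]].
        rewrite <- (seg_1 p y) at 2; apply Hsm; apply Rabs_def1; lra.
  - rewrite <- (seg_0 p y) at 1; rewrite dist_seg.
    rewrite Rabs_left1 by lra; nra.
Qed.

Lemma ball_in_of_boundary n D p e :
  inRn n p -> D p -> (forall z, boundary n D z -> e <= dist n p z) -> ball_in n D p e.
Proof.
  intros Hp HDp H y Hy Hd; apply NNPP; intros HDy.
  destruct (boundary_on_segment n D p y) as (z & Hz & Hle); auto.
  specialize (H z Hz); lra.
Qed.

(** * Length of curves *)

Lemma last_cons (y x : R) l : last (y :: l) x = last l y.
Proof.
  revert y x; induction l as [|z l IH]; intros y x; [reflexivity|].
  change (last (z :: l) x = last (z :: l) y); rewrite !IH; reflexivity.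
Qed.

Lemma partition_nil s t : partition s t nil <-> s = t.
Proof. unfold partition; simpl; tauto. Qed.

Lemma partition_cons s t y l : partition s t (y :: l) <-> s <= y /\ partition y t l.
Proof. unfold partition; rewrite last_cons; simpl; tauto. Qed.

Lemma partition_le l : forall s t, partition s t l -> s <= t.
Proof.
  induction l as [|y l IH]; intros s t H.
  - apply partition_nil in H; lra.
  - apply partition_cons in H as [H1 H2]; apply IH in H2; lra.
Qed.

Lemma partition_single s t : s <= t -> partition s t (t :: nil).
Proof. intros H; apply partition_cons; split; [assumption|apply partition_nil; reflexivity]. Qed.

Section Length.

Variables (n : nat) (g : R -> point).

Lemma partition_app m t l2 : partition m t l2 -> forall l1 s, partition s m l1 ->
  partition s t (l1 ++ l2) /\
  chain_sum n g s (l1 ++ l2) = chain_sum n g s l1 + chain_sum n g m l2.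
Proof.
  intros H2; induction l1 as [|y l1 IH]; intros s H1.
  - apply partition_nil in H1; subst; simpl; split; [assumption|ring].
  - apply partition_cons in H1 as [Hy H1]; apply IH in H1 as [HP HC].
    split; [apply partition_cons; auto|].
    cbn [app chain_sum]; rewrite HC; ring.
Qed.

Lemma chain_sum_nonneg l : forall s, 0 <= chain_sum n g s l.
Proof.
  induction l as [|y l IH]; intros s; simpl; [lra|].
  pose proof (dist_nonneg n (g s) (g y)); pose proof (IH y); lra.
Qed.

Lemma chain_sum_le_increment (tau : R -> R) a b :
  (forall s t, a <= s -> s <= t -> t <= b -> dist n (g s) (g t) <= tau t - tau s) ->
  forall l s t, a <= s -> t <= b -> partition s t l -> chain_sum n g s l <= tau t - tau s.
Proof.
  intros H; induction l as [|y l IH]; intros s t Hs Ht HP.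
  - apply partition_nil in HP; subst; simpl; lra.
  - apply partition_cons in HP as [Hy HP]; pose proof (partition_le _ _ _ HP).
    assert (dist n (g s) (g y) <= tau y - tau s) by (apply H; lra).
    assert (chain_sum n g y l <= tau t - tau y) by (apply IH; auto; lra).
    simpl; lra.
Qed.

Lemma partition_split l : forall s m t, partition s t l -> s <= m <= t ->
  exists l1 l2, partition s m l1 /\ partition m t l2 /\
    chain_sum n g s l <= chain_sum n g s l1 + chain_sum n g m l2.
Proof.
  induction l as [|y l IH]; intros s m t HP Hm.
  - apply partition_nil in HP; assert (s = m /\ m = t) as [-> ->] by lra.
    exists nil, nil; simpl; repeat split; auto; lra.
  - apply partition_cons in HP as [Hy HP].
    destruct (Rle_dec m y) as [Hle|Hgt].
    + exists (m :: nil), (y :: l); split; [|split].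
      * apply partition_single; lra.
      * apply partition_cons; auto.
      * simpl; pose proof (dist_triangle n (g s) (g m) (g y)); lra.
    + destruct (IH y m t) as (l1 & l2 & H1 & H2 & H3); [assumption|lra|].
      exists (y :: l1), l2; split; [|split].
      * apply partition_cons; auto.
      * assumption.
      * simpl; lra.
Qed.

Lemma chain_sum_le_length s t L l :
  curve_length n g s t L -> partition s t l -> chain_sum n g s l <= L.
Proof. intros [H _] HP; apply H; eauto. Qed.

Lemma length_le_bound s t L M :
  curve_length n g s t L ->
  (forall l, partition s t l -> chain_sum n g s l <= M) -> L <= M.
Proof. intros [_ H] HM; apply H; intros r (l & HP & ->); auto. Qed.

Lemma curve_length_approx s t L c : curve_length n g s t L -> c < L ->
  exists l, partition s t l /\ c < chain_sum n g s l.
Proof.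
  intros HL Hc; apply NNPP; intros Hno.
  assert (L <= c); [|lra].
  apply (length_le_bound s t L c HL); intros l HP.
  apply Rnot_lt_le; intros Hlt; apply Hno; eauto.
Qed.

Lemma curve_length_exists s t M : s <= t ->
  (forall l, partition s t l -> chain_sum n g s l <= M) ->
  exists L, curve_length n g s t L.
Proof.
  intros Hst HM.
  destruct (completeness (fun r => exists l, partition s t l /\ r = chain_sum n g s l))
    as [L HL].
  - exists M; intros r (l & HP & ->); auto.
  - exists (chain_sum n g s (t :: nil)), (t :: nil); split; [|reflexivity].
    apply partition_single; assumption.
  - exists L; exact HL.
Qed.

Lemma curve_length_unique s t L L' :
  curve_length n g s t L -> curve_length n g s t L' -> L = L'.
Proof. apply is_lub_u. Qed.

Lemma dist_le_length s t L : s <= t -> curve_length n g s t L -> dist n (g s) (g t) <= L.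
Proof.
  intros Hst HL; pose proof (chain_sum_le_length _ _ _ _ HL (partition_single s t Hst)).
  simpl in *; lra.
Qed.

Lemma curve_length_nonneg s t L : s <= t -> curve_length n g s t L -> 0 <= L.
Proof.
  intros Hst HL; pose proof (dist_le_length _ _ _ Hst HL).
  pose proof (dist_nonneg n (g s) (g t)); lra.
Qed.

Lemma curve_length_point s : curve_length n g s s 0.
Proof.
  split.
  - intros r (l & HP & ->).
    replace 0 with (0 * s - 0 * s) by ring.
    apply (chain_sum_le_increment (fun t => 0 * t) s s); auto; try lra.
    intros x y H1 H2 H3; assert (x = y) as -> by lra; rewrite dist_refl; lra.
  - intros M HM; apply HM; exists nil; split; [apply partition_nil|]; reflexivity.
Qed.

Lemma curve_length_add s m t A B : s <= m <= t ->
  curve_length n g s m A -> curve_length n g m t B -> curve_length n g s t (A + B).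
Proof.
  intros Hm HA HB; split.
  - intros r (l & HP & ->).
    destruct (partition_split l s m t HP Hm) as (l1 & l2 & H1 & H2 & H3).
    pose proof (chain_sum_le_length _ _ _ _ HA H1).
    pose proof (chain_sum_le_length _ _ _ _ HB H2); lra.
  - intros M HM; apply Rnot_lt_le; intros Hlt.
    destruct (curve_length_approx s m A (A - (A + B - M) / 2) HA) as (l1 & H1 & H1'); [lra|].
    destruct (curve_length_approx m t B (B - (A + B - M) / 2) HB) as (l2 & H2 & H2'); [lra|].
    destruct (partition_app m t l2 H2 l1 s H1) as [HP HC].
    assert (chain_sum n g s (l1 ++ l2) <= M) by (apply HM; eauto).
    lra.
Qed.

Lemma curve_length_split s m t L : s <= m <= t -> curve_length n g s t L ->
  exists A B, curve_length n g s m A /\ curve_length n g m t B /\ L = A + B.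
Proof.
  intros Hm HL.
  destruct (curve_length_exists s m L) as [A HA]; [lra| |].
  { intros l HP.
    destruct (partition_app m t (t :: nil) (partition_single m t (proj2 Hm)) l s HP) as [HP' HC].
    pose proof (chain_sum_le_length _ _ _ _ HL HP').
    pose proof (chain_sum_nonneg (t :: nil) m); lra. }
  destruct (curve_length_exists m t L) as [B HB]; [lra| |].
  { intros l HP.
    destruct (partition_app m t l HP (m :: nil) s (partition_single s m (proj1 Hm))) as [HP' HC].
    pose proof (chain_sum_le_length _ _ _ _ HL HP').
    pose proof (chain_sum_nonneg (m :: nil) s); lra. }
  exists A, B; split; [assumption|split; [assumption|]].
  eapply curve_length_unique; [exact HL|]; apply (curve_length_add s m t); auto.
Qed.

Lemma dist_le_length_diff a x x' u u' : a <= x -> a <= x' ->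
  curve_length n g a x u -> curve_length n g a x' u' ->
  dist n (g x) (g x') <= Rabs (u' - u).
Proof.
  assert (H : forall x x' u u', a <= x -> x <= x' ->
    curve_length n g a x u -> curve_length n g a x' u' ->
    dist n (g x) (g x') <= Rabs (u' - u)).
  { clear; intros x x' u u' Hx Hx' Hu Hu'.
    destruct (curve_length_split a x x' u') as (A & B & HA & HB & E); [lra|assumption|].
    rewrite (curve_length_unique _ _ _ _ Hu HA), E.
    apply dist_le_length in HB; [|assumption].
    eapply Rle_trans; [exact HB|].
    replace (A + B - A) with B by ring; apply Rle_abs. }
  intros Hx Hx' Hu Hu'; destruct (Rle_dec x x').
  - apply H; auto.
  - rewrite dist_sym, Rabs_minus_sym; apply H; auto; lra.
Qed.

Lemma chain_sum_move_start e l : forall t, partition t e l -> t < e ->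
  exists s0, t < s0 <= e /\ forall s, t <= s <= s0 ->
    exists l', partition s e l' /\
      chain_sum n g t l <= dist n (g t) (g s) + chain_sum n g s l'.
Proof.
  induction l as [|y l IH]; intros t HP Ht.
  - apply partition_nil in HP; lra.
  - apply partition_cons in HP as [Hy HP]; pose proof (partition_le _ _ _ HP).
    destruct (Req_dec t y) as [<-|Hne].
    + destruct (IH t HP Ht) as (s0 & Hs0 & Hs).
      exists s0; split; [assumption|]; intros s Hss.
      simpl; rewrite dist_refl, Rplus_0_l; auto.
    + exists y; split; [lra|]; intros s Hss.
      exists (y :: l); split; [apply partition_cons; split; [lra|assumption]|].
      simpl; pose proof (dist_triangle n (g t) (g s) (g y)); lra.
Qed.

Lemma chain_sum_move_end t l : forall x, partition x t l -> x < t ->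
  exists s0, x <= s0 < t /\ forall s, s0 <= s <= t ->
    exists l', partition x s l' /\
      chain_sum n g x l <= chain_sum n g x l' + dist n (g s) (g t).
Proof.
  induction l as [|y l IH]; intros x HP Hx.
  - apply partition_nil in HP; lra.
  - apply partition_cons in HP as [Hy HP]; pose proof (partition_le _ _ _ HP).
    destruct (Req_dec y t) as [->|Hne].
    + exists x; split; [lra|]; intros s Hs.
      exists (s :: nil); split; [apply partition_single; lra|].
      pose proof (chain_sum_le_length _ _ _ _ (curve_length_point t) HP).
      simpl; pose proof (dist_triangle n (g x) (g s) (g t)); lra.
    + destruct (IH y HP) as (s0 & Hs0 & Hs); [lra|].
      exists s0; split; [lra|]; intros s Hss.
      destruct (Hs s Hss) as (l' & HP' & HC).
      exists (y :: l'); split; [apply partition_cons; auto|simpl; lra].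
Qed.

Lemma curve_length_ivt a b L u : a <= b -> curve_cont n g a b ->
  curve_length n g a b L -> 0 <= u <= L ->
  exists t, a <= t <= b /\ curve_length n g a t u.
Proof.
  intros Hab Hcont HL Hu.
  set (E := fun t => a <= t <= b /\ exists A, curve_length n g a t A /\ A <= u).
  assert (HEa : E a).
  { split; [lra|]; exists 0; split; [apply curve_length_point|lra]. }
  destruct (completeness E) as [T [Hub Hlub]].
  { exists b; intros t [Ht _]; lra. }
  { exists a; exact HEa. }
  assert (HaT : a <= T) by (apply Hub, HEa).
  assert (HTb : T <= b) by (apply Hlub; intros t [Ht _]; lra).
  destruct (curve_length_split a T b L) as (A & B & HA & HB & EL); [lra|assumption|].
  exists T; split; [lra|].
  destruct (Rtotal_order A u) as [Hlt|[->|Hgt]]; [exfalso|assumption|exfalso].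
  - assert (HT : T < b).
    { destruct (Req_dec T b) as [->|]; [|lra].
      pose proof (curve_length_unique _ _ _ _ HB (curve_length_point b)); lra. }
    destruct (curve_length_approx T b B (L - u) HB) as (l & HP & Hl); [lra|].
    destruct (chain_sum_move_start b l T HP HT) as (s0 & Hs0 & Hs).
    destruct (Hcont T (conj HaT HTb) (chain_sum n g T l - (L - u))) as (del & Hdel & Hd); [lra|].
    set (s := Rmin s0 (T + del / 2)).
    assert (Hss : T < s <= s0 /\ s < T + del).
    { unfold s, Rmin; destruct (Rle_dec s0 (T + del / 2)); lra. }
    destruct (Hs s) as (l' & HP' & HC); [lra|].
    assert (Hds : dist n (g s) (g T) < chain_sum n g T l - (L - u)).
    { apply Hd; [lra|apply Rabs_def1; lra]. }
    rewrite dist_sym in Hds.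
    destruct (curve_length_split a s b L) as (A' & B' & HA' & HB' & EL'); [lra|assumption|].
    pose proof (chain_sum_le_length _ _ _ _ HB' HP').
    assert (s <= T); [|lra].
    apply Hub; split; [lra|]; exists A'; split; [assumption|lra].
  - assert (HT : a < T).
    { destruct (Req_dec a T) as [<-|]; [|lra].
      pose proof (curve_length_unique _ _ _ _ HA (curve_length_point a)); lra. }
    destruct (curve_length_approx a T A u HA) as (l & HP & Hl); [lra|].
    destruct (chain_sum_move_end T l a HP HT) as (s0 & Hs0 & Hs).
    destruct (Hcont T (conj HaT HTb) (chain_sum n g a l - u)) as (del & Hdel & Hd); [lra|].
    set (s1 := Rmax s0 (T - del / 2)).
    assert (Hs1 : s0 <= s1 < T /\ T - del < s1).
    { unfold s1, Rmax; destruct (Rle_dec s0 (T - del / 2)); lra. }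
    assert (T <= s1); [|lra].
    apply Hlub; intros t Ht; pose proof (Hub t Ht) as HtT.
    destruct Ht as [Ht (A' & HA' & HAu)].
    apply Rnot_lt_le; intros Hlt.
    destruct (Hs t) as (l' & HP' & HC); [lra|].
    assert (dist n (g t) (g T) < chain_sum n g a l - u).
    { apply Hd; [lra|apply Rabs_def1; lra]. }
    pose proof (chain_sum_le_length _ _ _ _ HA' HP'); lra.
Qed.

End Length.

Lemma arc_length_parametrization n g a b L : a <= b -> curve_cont n g a b ->
  curve_length n g a b L ->
  exists sigma : R -> R,
    (forall u, 0 <= u <= L -> a <= sigma u <= b /\ curve_length n g a (sigma u) u) /\
    (forall s t, 0 <= s -> s <= t -> t <= L ->
       curve_length n (fun u => g (sigma u)) s t (t - s)).
Proof.
  intros Hab Hcont HL.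
  set (sigma := fun u => epsilon (inhabits 0)
         (fun t => a <= t <= b /\ curve_length n g a t u)).
  assert (Hsig : forall u, 0 <= u <= L -> a <= sigma u <= b /\ curve_length n g a (sigma u) u).
  { intros u Hu; apply epsilon_spec, (curve_length_ivt n g a b L u); assumption. }
  exists sigma; split; [exact Hsig|].
  assert (Hpull : forall t, 0 <= t <= L -> forall l x u, a <= x -> 0 <= u ->
    curve_length n g a x u -> partition x (sigma t) l ->
    exists l', partition u t l' /\
      chain_sum n g x l <= chain_sum n (fun u => g (sigma u)) u l').
  { intros t Ht; destruct (Hsig t Ht) as [Hst Hlt].
    induction l as [|z l IH]; intros x u Hx Hu Hxu HP.
    - apply partition_nil in HP; subst x.
      exists nil; split; [|simpl; lra].
      apply partition_nil; eapply curve_length_unique; eauto.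
    - apply partition_cons in HP as [Hz HP]; pose proof (partition_le _ _ _ HP).
      destruct (curve_length_split n g a z (sigma t) t) as (w & w' & Hw & Hw' & Ew); [lra|assumption|].
      destruct (curve_length_split n g a x z w) as (v & v' & Hv & Hv' & Ev); [lra|assumption|].
      pose proof (curve_length_unique n g _ _ _ _ Hxu Hv) as <-.
      pose proof (curve_length_nonneg n g _ _ _ Hz Hv').
      apply curve_length_nonneg in Hw'; [|assumption].
      destruct (IH z w) as (l' & HP' & HC); [lra|lra|assumption|assumption|].
      exists (w :: l'); split; [apply partition_cons; split; [lra|assumption]|].
      destruct (Hsig u) as [Hsu Hlu]; [lra|].
      destruct (Hsig w) as [Hsw Hlw]; [lra|].
      assert (E1 : dist n (g x) (g (sigma u)) <= 0).
      { rewrite <- Rabs_R0; rewrite <- (Rminus_diag u).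
        apply (dist_le_length_diff n g a); auto; lra. }
      assert (E2 : dist n (g (sigma w)) (g z) <= 0).
      { rewrite <- Rabs_R0; rewrite <- (Rminus_diag w).
        apply (dist_le_length_diff n g a); auto; lra. }
      pose proof (dist_triangle n (g x) (g (sigma u)) (g z)).
      pose proof (dist_triangle n (g (sigma u)) (g (sigma w)) (g z)).
      simpl; lra. }
  intros s t Hs Hst Ht.
  destruct (Hsig s) as [Hss Hls]; [lra|]; destruct (Hsig t) as [Hts Hlt]; [lra|].
  split.
  - intros r (l & HP & ->).
    apply (chain_sum_le_increment n _ (fun x => x) s t); [|lra|lra|assumption].
    intros x y Hx Hxy Hy; rewrite <- (Rabs_right (y - x)) by lra.
    destruct (Hsig x); [lra|]; destruct (Hsig y); [lra|].
    apply (dist_le_length_diff n g a); auto; lra.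
  - intros M HM.
    destruct (Rle_dec (sigma s) (sigma t)) as [Hle|Hgt].
    + destruct (curve_length_split n g a (sigma s) (sigma t) t) as (A & B & HA & HB & E);
        [lra|assumption|].
      rewrite <- (curve_length_unique n g _ _ _ _ Hls HA) in E.
      replace (t - s) with B by lra.
      apply (length_le_bound n g _ _ _ _ HB); intros l HP.
      destruct (Hpull t ltac:(lra) l (sigma s) s) as (l' & HP' & HC); [lra|lra|assumption..|].
      eapply Rle_trans; [exact HC|]; apply HM; eauto.
    + destruct (curve_length_split n g a (sigma t) (sigma s) s) as (A & B & HA & HB & E);
        [lra|assumption|].
      pose proof (curve_length_unique n g _ _ _ _ Hlt HA).
      apply curve_length_nonneg in HB; [|lra].
      assert (0 <= M); [|lra].
      eapply Rle_trans; [apply dist_nonneg|].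
      eapply Rle_trans; [|apply HM; exists (t :: nil); split;
        [apply partition_single; assumption|reflexivity]].
      simpl; apply Req_le; symmetry; apply Rplus_0_r.
Qed.

(** * The function psi *)

Lemma phi_le phi s t : phi_conditions phi -> 0 <= s -> s <= t -> phi s <= phi t.
Proof.
  intros (_ & _ & Hinc & _) Hs Hst; destruct (Req_dec s t) as [->|]; [lra|].
  left; apply Hinc; lra.
Qed.

Lemma phi1_pos phi : phi_conditions phi -> 0 < phi 1.
Proof. intros (_ & _ & Hinc & H0 & _); rewrite <- H0; apply Hinc; lra. Qed.

Lemma psi_0 phi : phi_conditions phi -> psi phi 0 = 0.
Proof.
  intros (_ & _ & _ & H0 & _); unfold psi; destruct (Rle_dec 0 1); [assumption|lra].
Qed.

Lemma psi_large phi t : 1 <= t -> psi phi t = phi 1 * t.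
Proof.
  intros Ht; unfold psi; destruct (Rle_dec t 1); [|reflexivity].
  replace t with 1 by lra; ring.
Qed.

Lemma psi_small phi t : t <= 1 -> psi phi t = phi t.
Proof. intros Ht; unfold psi; destruct (Rle_dec t 1); [reflexivity|lra]. Qed.

Lemma psi_le phi s t : phi_conditions phi -> 0 <= s -> s <= t -> psi phi s <= psi phi t.
Proof.
  intros Hphi Hs Hst; pose proof (phi1_pos phi Hphi).
  destruct (Rle_dec t 1).
  - rewrite !psi_small by lra; apply phi_le; assumption.
  - rewrite (psi_large phi t) by lra; destruct (Rle_dec s 1).
    + rewrite psi_small by lra.
      pose proof (phi_le phi s 1 Hphi Hs ltac:(lra)); nra.
    + rewrite psi_large by lra; nra.
Qed.

Lemma psi_nonneg phi t : phi_conditions phi -> 0 <= t -> 0 <= psi phi t.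
Proof. intros Hphi Ht; rewrite <- (psi_0 phi Hphi); apply psi_le; auto; lra. Qed.

Lemma psi_pos phi t : phi_conditions phi -> 0 < t -> 0 < psi phi t.
Proof.
  intros Hphi Ht; pose proof (phi1_pos phi Hphi); destruct (Rle_dec t 1).
  - rewrite psi_small by lra; destruct Hphi as (_ & _ & Hinc & H0 & _).
    rewrite <- H0; apply Hinc; lra.
  - rewrite psi_large by lra; nra.
Qed.

(** * Loop erasure along inscribed polygons *)

Definition lipschitz1 (n : nat) (g : R -> point) (a b : R) : Prop :=
  forall s t, a <= s -> s <= t -> t <= b -> dist n (g s) (g t) <= t - s.

Lemma lipschitz1_cont n g a b : lipschitz1 n g a b -> curve_cont n g a b.
Proof.
  intros H t Ht eps Heps; exists eps; split; [assumption|]; intros s Hs Hd.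
  apply Rabs_def2 in Hd; destruct (Rle_dec s t).
  - pose proof (H s t); lra.
  - rewrite dist_sym; pose proof (H t s); lra.
Qed.

Lemma lipschitz1_abs n g a b s t : lipschitz1 n g a b ->
  a <= s <= b -> a <= t <= b -> dist n (g s) (g t) <= Rabs (t - s).
Proof.
  intros H Hs Ht; destruct (Rle_dec s t).
  - rewrite Rabs_right by lra; apply H; lra.
  - rewrite dist_sym, Rabs_left by lra; replace (- (t - s)) with (s - t) by ring; apply H; lra.
Qed.

Lemma nearest_parameter n S h p : 0 <= h -> lipschitz1 n S 0 h ->
  exists c0, 0 <= c0 <= h /\ forall c, 0 <= c <= h -> dist n p (S c0) <= dist n p (S c).
Proof.
  intros Hh HS.
  set (clamp := fun x => Rmax 0 (Rmin h x)).
  assert (Hcl : forall x, 0 <= clamp x <= h).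
  { intros x; unfold clamp, Rmax, Rmin; destruct (Rle_dec h x); destruct (Rle_dec 0 _); lra. }
  assert (Hid : forall x, 0 <= x <= h -> clamp x = x).
  { intros x Hx; unfold clamp, Rmax, Rmin; destruct (Rle_dec h x); destruct (Rle_dec 0 _); lra. }
  assert (Hcl1 : forall x y, Rabs (clamp x - clamp y) <= Rabs (x - y)).
  { intros x y; unfold clamp, Rmax, Rmin.
    destruct (Rle_dec h x), (Rle_dec h y), (Rle_dec 0 h), (Rle_dec 0 x), (Rle_dec 0 y);
      try lra; unfold Rabs; repeat destruct (Rcase_abs _); lra. }
  destruct (continuity_ab_min (fun x => dist n p (S (clamp x))) 0 h Hh) as (c0 & Hmin & Hc0).
  { intros c _ eps Heps; exists eps; split; [assumption|].
    intros x [_ Hx]; simpl in *; unfold Rdist in *.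
    eapply Rle_lt_trans; [|exact Hx].
    eapply Rle_trans; [|apply Hcl1].
    pose proof (lipschitz1_abs n S 0 h (clamp c) (clamp x) HS (Hcl c) (Hcl x)).
    pose proof (dist_triangle n p (S (clamp c)) (S (clamp x))).
    pose proof (dist_triangle n p (S (clamp x)) (S (clamp c))) as H2.
    rewrite (dist_sym n (S (clamp x))) in H2.
    apply Rabs_le; lra. }
  exists c0; split; [assumption|]; intros c Hc.
  specialize (Hmin c Hc); simpl in Hmin; rewrite !Hid in Hmin; assumption.
Qed.

Lemma first_hit n Q S u h : 0 <= u -> 0 <= h ->
  lipschitz1 n Q 0 u -> lipschitz1 n S 0 h ->
  (forall t, inRn n (Q t)) -> (forall c, inRn n (S c)) -> Q u = S 0 ->
  exists t c, 0 <= t <= u /\ 0 <= c <= h /\ Q t = S c /\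
    forall s c', 0 <= s < t -> 0 <= c' <= h -> Q s <> S c'.
Proof.
  intros Hu Hh HQ HS HQn HSn Hend.
  set (A := fun s => 0 <= s <= u /\ exists c, 0 <= c <= h /\ Q s = S c).
  assert (HAu : A u) by (split; [lra|exists 0; split; [lra|assumption]]).
  destruct (completeness (fun x => 0 <= x <= u /\ forall s, A s -> x <= s)) as [t [Hub Hlub]].
  { exists u; intros x [Hx _]; lra. }
  { exists 0; split; [lra|]; intros s [Hs _]; lra. }
  assert (Ht0 : 0 <= t) by (apply Hub; split; [lra|]; intros s [Hs _]; lra).
  assert (HtA : forall s, A s -> t <= s).
  { intros s Hs; apply Hlub; intros x [_ Hx]; auto. }
  assert (Htu : t <= u) by auto.
  destruct (nearest_parameter n S h (Q t) Hh HS) as (c & Hc & Hmin).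
  assert (Heq : Q t = S c).
  { apply (dist_eq0 n); auto.
    pose proof (dist_nonneg n (Q t) (S c)).
    destruct (Req_dec (dist n (Q t) (S c)) 0) as [|Hne]; [assumption|exfalso].
    set (m := dist n (Q t) (S c)) in *.
    assert (Hex : exists s, A s /\ s < t + m).
    { apply NNPP; intros Hno.
      assert (Hall : forall s, A s -> t + m <= s).
      { intros s Hs; apply Rnot_lt_le; intros Hlt; apply Hno; eauto. }
      assert (t + m <= t); [|lra].
      apply Hub; split; [|assumption]; specialize (Hall u HAu); lra. }
    destruct Hex as (s & HsA & Hs).
    pose proof (HtA s HsA) as Hts; destruct HsA as (Hs0 & c' & Hc' & E).
    specialize (Hmin c' Hc'); rewrite <- E in Hmin.
    pose proof (HQ t s Ht0 Hts (proj2 Hs0)); lra. }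
  exists t, c; repeat split; try tauto; try lra.
  intros s c' Hs Hc' E; assert (t <= s); [|lra].
  apply HtA; split; [lra|eauto].
Qed.

(* [tau] records from which instant of [P] each point of the erased curve
   comes; bounding increments of [Q] by those of [tau] is what makes subarcs of
   [Q] no longer than the corresponding pieces of [P]. *)
Lemma loop_erasure n P h k : 0 < h ->
  lipschitz1 n P 0 (INR k * h) -> (forall t, 0 <= t <= INR k * h -> inRn n (P t)) ->
  exists (u : R) (Q : R -> point) (tau : R -> R),
    0 <= u /\ lipschitz1 n Q 0 u /\
    (forall s t, 0 <= s <= u -> 0 <= t <= u -> Q s = Q t -> s = t) /\
    (forall t, inRn n (Q t)) /\
    Q 0 = P 0 /\ Q u = P (INR k * h) /\
    (forall s, 0 <= s <= u -> 0 <= tau s <= INR k * h) /\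
    (forall s t, 0 <= s -> s <= t -> t <= u -> dist n (Q s) (Q t) <= tau t - tau s) /\
    (forall s, 0 <= s <= u -> dist n (Q s) (P (tau s)) <= 2 * h).
Proof.
  intros Hh HP HPn; induction k as [|k IH].
  - exists 0, (fun _ => P 0), (fun _ => 0).
    change (INR 0) with 0; rewrite Rmult_0_l.
    assert (HP0 : inRn n (P 0)) by (apply HPn; simpl; lra).
    repeat split; auto; try lra; intros; try (intros s t ? ? ?); rewrite ?dist_refl; lra.
  - rewrite S_INR in HP, HPn |- *.
    assert (HTk : 0 <= INR k * h) by (pose proof (pos_INR k); nra).
    destruct IH as (u & Q & tau & Hu & HQ & Hinj & HQn & HQ0 & HQu & Htau & Hinc & Hclose).
    { intros s t Hs Hst Ht; apply HP; auto; nra. }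
    { intros t Ht; apply HPn; nra. }
    set (T := INR k * h) in *.
    replace ((INR k + 1) * h) with (T + h) in * by (unfold T; ring).
    destruct (classic (P T = P (T + h))) as [Edeg|Hne].
    + exists u, Q, tau; repeat split; auto; try congruence.
      * apply Htau; assumption.
      * destruct (Htau s); [assumption|lra].
    + pose proof (dist_pos n _ _ (HPn T ltac:(lra)) (HPn (T + h) ltac:(lra)) Hne) as HdP.
      assert (HdPh : dist n (P T) (P (T + h)) <= h).
      { eapply Rle_trans; [apply HP|]; lra. }
      set (S := fun c => seg (P T) (P (T + h)) (c / h)).
      assert (HSn : forall c, inRn n (S c)) by (intros; apply inRn_seg; apply HPn; lra).
      assert (HSd : forall c c', dist n (S c) (S c') =
                Rabs (c - c') * (dist n (P T) (P (T + h)) / h)).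
      { intros c c'; unfold S; rewrite dist_seg.
        replace (c / h - c' / h) with ((c - c') / h) by (field; lra).
        unfold Rdiv; rewrite Rabs_mult, (Rabs_right (/ h)); [ring|].
        left; apply Rinv_0_lt_compat; assumption. }
      assert (Hrat : 0 < dist n (P T) (P (T + h)) / h <= 1).
      { split; [apply Rdiv_lt_0_compat; assumption|].
        apply Rmult_le_reg_r with h; [assumption|].
        unfold Rdiv; rewrite Rmult_assoc, Rinv_l by lra; lra. }
      assert (HSlip : forall c c', c <= c' -> dist n (S c) (S c') <= c' - c).
      { intros c c' Hc; rewrite HSd, Rabs_minus_sym, Rabs_right by lra; nra. }
      assert (HSinj : forall c c', S c = S c' -> c = c').
      { intros c c' E.
        assert (E0 : dist n (S c) (S c') = 0) by (rewrite E; apply dist_refl).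
        rewrite HSd in E0; apply Rmult_integral in E0 as [E0|E0]; [|lra].
        destruct (Req_dec (c - c') 0) as [|Hn]; [lra|].
        apply Rabs_no_R0 in Hn; contradiction. }
      assert (HS0 : S 0 = P T).
      { unfold S; replace (0 / h) with 0 by (field; lra); apply seg_0. }
      assert (HSh : S h = P (T + h)).
      { unfold S; replace (h / h) with 1 by (field; lra); apply seg_1. }
      destruct (first_hit n Q S u h Hu) as (t0 & c0 & Ht0 & Hc0 & E & Hfirst);
        auto; [lra|intros c c' _ Hc _; auto|congruence|].
      exists (t0 + (h - c0)),
        (fun s => if Rle_dec s t0 then Q s else S (c0 + (s - t0))),
        (fun s => if Rle_dec s t0 then tau s else T + (c0 + (s - t0))).
      assert (Hcross : forall s t, 0 <= s -> s <= t0 -> t0 <= t ->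
        dist n (Q s) (S (c0 + (t - t0))) <= dist n (Q s) (Q t0) + (t - t0)).
      { intros s t Hs Hst Ht.
        pose proof (dist_triangle n (Q s) (Q t0) (S (c0 + (t - t0)))).
        pose proof (HSlip c0 (c0 + (t - t0)) ltac:(lra)); rewrite <- E in *; lra. }
      split; [lra|]. split; [|split; [|split; [|split; [|split; [|split; [|split]]]]]].
      * intros s t Hs Hst Ht.
        destruct (Rle_dec s t0), (Rle_dec t t0); try lra.
        -- apply HQ; lra.
        -- pose proof (Hcross s t); pose proof (HQ s t0); lra.
        -- eapply Rle_trans; [apply HSlip|]; lra.
      * intros s t Hs Ht; destruct (Rle_dec s t0), (Rle_dec t t0); intros Est.
        -- apply Hinj; auto; lra.
        -- exfalso; destruct (Req_dec s t0) as [->|].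
           ++ rewrite E in Est; apply HSinj in Est; lra.
           ++ apply (Hfirst s (c0 + (t - t0))); auto; lra.
        -- exfalso; destruct (Req_dec t t0) as [->|].
           ++ rewrite E in Est; apply HSinj in Est; lra.
           ++ apply (Hfirst t (c0 + (s - t0))); auto; lra.
        -- apply HSinj in Est; lra.
      * intros t; destruct (Rle_dec t t0); auto.
      * destruct (Rle_dec 0 t0); [assumption|lra].
      * destruct (Rle_dec (t0 + (h - c0)) t0).
        -- replace (t0 + (h - c0)) with t0 by lra; rewrite E, <- HSh; f_equal; lra.
        -- rewrite <- HSh; f_equal; lra.
      * intros s Hs; destruct (Rle_dec s t0); [|lra].
        destruct (Htau s); lra.
      * intros s t Hs Hst Ht; destruct (Rle_dec s t0), (Rle_dec t t0); try lra.
        -- apply Hinc; lra.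
        -- pose proof (Hcross s t); pose proof (Hinc s t0).
           destruct (Htau t0); lra.
        -- eapply Rle_trans; [apply HSlip|]; lra.
      * intros s Hs; destruct (Rle_dec s t0); [apply Hclose; lra|].
        set (c := c0 + (s - t0)).
        pose proof (HSlip 0 c ltac:(unfold c; lra)) as H1.
        rewrite HS0, dist_sym in H1.
        pose proof (HP T (T + c) ltac:(lra) ltac:(unfold c; lra) ltac:(unfold c; lra)).
        pose proof (dist_triangle n (S c) (P T) (P (T + c))).
        assert (c <= h) by (unfold c; lra); lra.
Qed.

(** * John curves yield cigars *)

Lemma psi_john_balls n phi D alpha beta :
  phi_conditions phi -> domain n D -> psi_john n phi D alpha beta ->
  exists x0 c, 0 < c /\ D x0 /\
  forall x, D x -> exists g l delta, 0 <= l /\ 0 < delta /\ lipschitz1 n g 0 l /\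
    g 0 = x /\ g l = x0 /\
    forall t, 0 <= t <= l -> D (g t) /\
      ball_in n D (g t) (c * psi phi t) /\ ball_in n D (g t) delta.
Proof.
  intros Hphi (HDn & _ & Hop & _) (Halpha & Hbeta & x0 & Hx0 & HJ).
  destruct (Hop x0 Hx0) as (r0 & Hr0 & Hball0).
  pose proof (psi_pos phi beta Hphi Hbeta) as Hpb.
  set (c := Rmin (r0 / (2 * psi phi beta)) (r0 / (2 * alpha))).
  assert (Hc : 0 < c) by (apply Rmin_pos; apply Rdiv_lt_0_compat; lra).
  assert (Hc1 : c * psi phi beta <= r0 / 2).
  { apply Rle_trans with (r0 / (2 * psi phi beta) * psi phi beta).
    - apply Rmult_le_compat_r; [lra|apply Rmin_l].
    - right; field; lra. }
  assert (Hc2 : c * alpha <= r0 / 2).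
  { apply Rle_trans with (r0 / (2 * alpha) * alpha).
    - apply Rmult_le_compat_r; [lra|apply Rmin_r].
    - right; field; lra. }
  exists x0, c; split; [assumption|split; [assumption|]]; intros x Hx.
  destruct (HJ x Hx) as (g & l & Hl & _ & Hlen & Hg0 & Hgl & HgD & Hlb & Hcond).
  destruct (Hop x Hx) as (r & Hr & Hball).
  assert (Hlip : lipschitz1 n g 0 l).
  { intros s t Hs Hst Ht; apply dist_le_length; auto. }
  assert (Hpsi : forall t, 0 <= t <= l -> ball_in n D (g t) (c * psi phi t)).
  { intros t Ht; destruct (Rle_dec l (r0 / 2)) as [Hsmall|Hbig].
    - apply ball_in_le with (r0 / 2).
      + apply Rle_trans with (c * psi phi beta); [|assumption].
        apply Rmult_le_compat_l; [lra|]; apply psi_le; auto; lra.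
      + apply ball_in_shrink with x0 r0; [|exact Hball0].
        rewrite <- Hgl, dist_sym; pose proof (Hlip t l); lra.
    - apply ball_in_of_boundary; auto; intros z Hz.
      specialize (Hcond t Ht z Hz).
      pose proof (dist_nonneg n (g t) z) as Hd.
      apply Rle_trans with (c * (alpha / l * dist n (g t) z)).
      { apply Rmult_le_compat_l; lra. }
      replace (c * (alpha / l * dist n (g t) z)) with ((c * alpha) / l * dist n (g t) z)
        by (field; lra).
      assert (c * alpha / l <= 1).
      { apply Rmult_le_reg_r with l; [lra|].
        unfold Rdiv; rewrite Rmult_assoc, Rinv_l by lra; lra. }
      nra. }
  assert (Hpr : 0 < c * psi phi (r / 2)).
  { apply Rmult_lt_0_compat; [assumption|apply psi_pos; auto; lra]. }
  exists g, l, (Rmin (r / 2) (c * psi phi (r / 2))).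
  split; [assumption|]. split; [apply Rmin_pos; lra|].
  repeat split; auto.
  destruct (Rle_dec t (r / 2)) as [Hsmall|Hbig].
  - apply ball_in_le with (r / 2); [apply Rmin_l|].
    apply ball_in_shrink with x r; [|exact Hball].
    rewrite <- Hg0; pose proof (Hlip 0 t); lra.
  - apply ball_in_le with (c * psi phi t); [|auto].
    eapply Rle_trans; [apply Rmin_r|].
    apply Rmult_le_compat_l; [lra|apply psi_le; auto; lra].
Qed.

Lemma cigar_of_psi_john n phi D alpha beta :
  phi_conditions phi -> domain n D -> psi_john n phi D alpha beta ->
  exists cJ, cigar_john n phi D cJ.
Proof.
  intros Hphi Hdom HJ; pose proof (proj1 Hdom) as HDn.
  destruct (psi_john_balls n phi D alpha beta Hphi Hdom HJ) as (x0 & c & Hc & Hx0 & Hcurve).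
  exists (2 / c); split; [apply Rdiv_lt_0_compat; lra|].
  intros a b Ha Hb Hab.
  destruct (Hcurve a Ha) as (ga & la & da & Hla & Hda & Hlipa & Hga0 & Hgal & Hbda).
  destruct (Hcurve b Hb) as (gb & lb & db & Hlb & Hdb & Hlipb & Hgb0 & Hgbl & Hbdb).
  set (P := fun t => if Rle_dec t la then ga t else gb (la + lb - t)).
  set (delta := Rmin da db).
  assert (Hdelta : 0 < delta) by (apply Rmin_pos; assumption).
  assert (HPd : forall t, 0 <= t <= la + lb -> D (P t) /\
    ball_in n D (P t) (c * psi phi (Rmin t (la + lb - t))) /\ ball_in n D (P t) delta).
  { intros t Ht.
    assert (Hq : 0 <= Rmin t (la + lb - t)) by (apply Rmin_glb; lra).
    unfold P; destruct (Rle_dec t la).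
    - destruct (Hbda t) as (H1 & H2 & H3); [lra|]; repeat split; [assumption| |].
      + eapply ball_in_le; [|exact H2]; apply Rmult_le_compat_l; [lra|].
        apply psi_le; auto; apply Rmin_l.
      + eapply ball_in_le; [|exact H3]; apply Rmin_l.
    - destruct (Hbdb (la + lb - t)) as (H1 & H2 & H3); [lra|]; repeat split; [assumption| |].
      + eapply ball_in_le; [|exact H2]; apply Rmult_le_compat_l; [lra|].
        apply psi_le; auto; apply Rmin_r.
      + eapply ball_in_le; [|exact H3]; apply Rmin_r. }
  assert (HPlip : lipschitz1 n P 0 (la + lb)).
  { intros s t Hs Hst Ht; unfold P; destruct (Rle_dec s la), (Rle_dec t la); try lra.
    - apply Hlipa; lra.
    - pose proof (Hlipa s la); pose proof (Hlipb (la + lb - t) lb).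
      pose proof (dist_triangle n (ga s) x0 (gb (la + lb - t))) as H1.
      rewrite <- Hgal in H1 at 1; rewrite <- Hgbl in H1.
      rewrite (dist_sym n (gb lb)) in H1; lra.
    - rewrite dist_sym; pose proof (Hlipb (la + lb - t) (la + lb - s)); lra. }
  assert (HP0 : P 0 = a) by (unfold P; destruct (Rle_dec 0 la); [assumption|lra]).
  assert (HPT : P (la + lb) = b).
  { unfold P; destruct (Rle_dec (la + lb) la).
    - assert (lb = 0) as E by lra; rewrite E in *.
      rewrite Rplus_0_r; congruence.
    - replace (la + lb - (la + lb)) with 0 by ring; assumption. }
  set (T := la + lb) in *.
  assert (HT : 0 < T).
  { destruct (Req_dec T 0) as [E|]; [|unfold T in *; lra].
    elim Hab; rewrite <- HP0, <- HPT, E; reflexivity. }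
  destruct (archimed_cor1 (delta / (4 * T))) as (N & HN & HN0).
  { apply Rdiv_lt_0_compat; lra. }
  apply lt_0_INR in HN0.
  set (h := T * / INR N).
  assert (Hh : 0 < h) by (apply Rmult_lt_0_compat; [assumption|apply Rinv_0_lt_compat; assumption]).
  assert (HNh : INR N * h = T) by (unfold h; field; lra).
  assert (Hhd : 4 * h < delta).
  { replace delta with (4 * T * (delta / (4 * T))) by (field; lra).
    unfold h; nra. }
  destruct (loop_erasure n P h N Hh) as
    (u & Q & tau & Hu & HQ & Hinj & HQn & HQ0 & HQu & Htau & Hinc & Hclose).
  { rewrite HNh; assumption. }
  { rewrite HNh; intros t Ht; apply HDn, HPd; assumption. }
  rewrite HNh, HPT in HQu; rewrite HP0 in HQ0; rewrite HNh in Htau.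
  assert (Hu0 : 0 < u).
  { destruct (Req_dec u 0) as [E|]; [|lra].
    elim Hab; rewrite <- HQ0, <- HQu, E; reflexivity. }
  assert (Hsc : forall t, 0 <= t <= 1 -> 0 <= u * t <= u) by (intros; nra).
  assert (Hlen : forall l s t, 0 <= s -> t <= 1 -> partition s t l ->
    chain_sum n (fun s => Q (u * s)) s l <= tau (u * t) - tau (u * s)).
  { apply (chain_sum_le_increment n (fun s => Q (u * s)) (fun s => tau (u * s))).
    intros s t Hs Hst Ht; apply Hinc; nra. }
  exists (fun s => Q (u * s)); repeat split.
  - intros t Ht eps Heps; exists (eps / u); split; [apply Rdiv_lt_0_compat; assumption|].
    intros s Hs Hd.
    eapply Rle_lt_trans; [apply (lipschitz1_abs n Q 0 u); auto|].
    replace eps with (u * (eps / u)) by (field; lra).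
    rewrite Rabs_minus_sym, <- Rmult_minus_distr_l, Rabs_mult, (Rabs_right u) by lra.
    apply Rmult_lt_compat_l; assumption.
  - intros s t Hs Ht E; apply Hinj in E; auto; apply Rmult_eq_reg_l with u; lra.
  - rewrite Rmult_0_r; assumption.
  - rewrite Rmult_1_r; assumption.
  - intros t Ht; specialize (Hsc t Ht).
    destruct (HPd _ (Htau _ Hsc)) as (_ & _ & Hb3).
    apply Hb3; [auto|]; rewrite dist_sym; pose proof (Hclose _ Hsc); lra.
  - apply (curve_length_exists _ _ _ _ (tau (u * 1) - tau (u * 0))); [lra|].
    intros l Hl; apply Hlen; auto; lra.
  - intros t Ht L1 L2 HL1 HL2 y Hy Hd.
    assert (Hut : 0 <= u * t <= u) by (apply Hsc; lra).
    pose proof (Htau _ Hut) as Htt; pose proof (Hclose _ Hut) as Hct.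
    assert (Hq1 : L1 <= tau (u * t)).
    { pose proof (Htau (u * 0) ltac:(nra)).
      eapply length_le_bound; [exact HL1|]; intros l Hl.
      pose proof (Hlen l 0 t ltac:(lra) ltac:(lra) Hl); lra. }
    assert (Hq2 : L2 <= T - tau (u * t)).
    { pose proof (Htau (u * 1) ltac:(nra)).
      eapply length_le_bound; [exact HL2|]; intros l Hl.
      pose proof (Hlen l t 1 ltac:(lra) ltac:(lra) Hl); lra. }
    assert (Hq : psi phi (Rmin L1 L2) <= psi phi (Rmin (tau (u * t)) (T - tau (u * t)))).
    { apply psi_le; [assumption| |].
      - apply Rmin_glb; [apply (curve_length_nonneg _ _ _ _ _ (Rlt_le _ _ (proj1 Ht)) HL1)
                        |apply (curve_length_nonneg _ _ _ _ _ (Rlt_le _ _ (proj2 Ht)) HL2)].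
      - apply Rmin_glb; [eapply Rle_trans; [apply Rmin_l|]|eapply Rle_trans; [apply Rmin_r|]];
          assumption. }
    destruct (HPd _ Htt) as (_ & Hb2 & Hb3).
    set (p := psi phi (Rmin (tau (u * t)) (T - tau (u * t)))) in *.
    replace (psi phi (Rmin L1 L2) / (2 / c)) with (c * psi phi (Rmin L1 L2) / 2) in Hd
      by (field; lra).
    assert (c * psi phi (Rmin L1 L2) <= c * p) by (apply Rmult_le_compat_l; lra).
    pose proof (dist_triangle n (P (tau (u * t))) (Q (u * t)) y) as Htri.
    rewrite (dist_sym n (P _) (Q _)) in Htri.
    destruct (Rle_dec delta (c * p)); [apply Hb2|apply Hb3]; auto; lra.
Qed.

(** * Cigars yield John curves *)

Lemma dist_le_diam n D d x y : is_diam n D d -> D x -> D y -> dist n x y <= d.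
Proof. intros [H _] Hx Hy; apply H; eauto. Qed.

Lemma diam_approx n D d c : is_diam n D d -> c < d ->
  exists x y, D x /\ D y /\ c < dist n x y.
Proof.
  intros [_ H] Hc; apply NNPP; intros Hno.
  assert (d <= c); [|lra].
  apply H; intros r (x & y & Hx & Hy & ->).
  apply Rnot_lt_le; intros Hlt; apply Hno; eauto.
Qed.

Lemma ball_in_diam n D d p e : (1 <= n)%nat -> is_diam n D d -> inRn n p ->
  ball_in n D p e -> 2 * e <= d.
Proof.
  intros Hn Hd Hp Hb.
  destruct (Rle_dec e 0) as [He|He].
  { destruct Hd as [Hub Hlub]; apply Rle_trans with 0; [lra|].
    apply Rnot_lt_le; intros Hlt.
    destruct (diam_approx n D d (d - 1) (conj Hub Hlub)) as (x & y & Hx & Hy & _); [lra|].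
    pose proof (dist_le_diam n D d x y (conj Hub Hlub) Hx Hy).
    pose proof (dist_nonneg n x y); lra. }
  apply Rnot_lt_le; intros Hlt.
  assert (Hin : forall s, Rabs s < e -> D (shift p s)).
  { intros s Hs; apply Hb; [apply inRn_shift; assumption|].
    rewrite <- (shift_0 p) at 1; rewrite dist_shift by assumption.
    rewrite Rabs_minus_sym, Rminus_0_r; assumption. }
  set (s := (Rmax 0 (d / 2) + e) / 2).
  assert (Hs : 0 < s < e /\ d / 2 < s).
  { unfold s, Rmax; destruct (Rle_dec 0 (d / 2)); lra. }
  assert (H1 : D (shift p s)) by (apply Hin; apply Rabs_def1; lra).
  assert (H2 : D (shift p (- s))) by (apply Hin; apply Rabs_def1; lra).
  pose proof (dist_le_diam n D d _ _ Hd H1 H2) as H3.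
  rewrite dist_shift, Rabs_right in H3 by (assumption || lra); lra.
Qed.

Lemma cigar_arc n phi D cJ a b : domain n D -> cigar_john n phi D cJ ->
  D a -> D b -> a <> b ->
  exists g L, 0 < L /\ dist n a b <= L /\ g 0 = a /\ g L = b /\
    (forall t, 0 <= t <= L -> D (g t)) /\
    (forall s t, 0 <= s -> s <= t -> t <= L -> curve_length n g s t (t - s)) /\
    (forall t, 0 < t < L -> ball_in n D (g t) (psi phi (Rmin t (L - t)) / cJ)).
Proof.
  intros [HDn _] [HcJ HC] Ha Hb Hab.
  destruct (HC a b Ha Hb Hab) as (g & Hcont & _ & Hg0 & Hg1 & HgD & [L HL] & Hball).
  pose proof (dist_le_length n g 0 1 L ltac:(lra) HL) as HdL; rewrite Hg0, Hg1 in HdL.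
  pose proof (dist_pos n a b (HDn a Ha) (HDn b Hb) Hab).
  destruct (arc_length_parametrization n g 0 1 L ltac:(lra) Hcont HL) as (sigma & Hsig & Hlen).
  assert (Hval : forall x u, 0 <= x <= 1 -> 0 <= u <= L -> curve_length n g 0 x u ->
    g (sigma u) = g x).
  { intros x u Hx Hu Hxu; destruct (Hsig u Hu) as [H1 H2].
    apply (dist_eq0 n); auto.
    pose proof (dist_le_length_diff n g 0 _ _ _ _ (proj1 H1) (proj1 Hx) H2 Hxu) as H3.
    rewrite Rminus_diag, Rabs_R0 in H3.
    pose proof (dist_nonneg n (g (sigma u)) (g x)); lra. }
  exists (fun u => g (sigma u)), L.
  split; [lra|]. split; [assumption|]. split; [|split; [|split; [|split; [assumption|]]]].
  - rewrite <- Hg0; apply Hval; [lra|lra|apply curve_length_point].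
  - rewrite <- Hg1; apply Hval; [lra|lra|assumption].
  - intros t Ht; apply HgD, Hsig, Ht.
  - intros t Ht y Hy Hd.
    destruct (Hsig t) as [Hst Hlt]; [lra|].
    destruct (curve_length_split n g 0 (sigma t) 1 L Hst HL) as (A & B & HA & HB & E).
    pose proof (curve_length_unique _ _ _ _ _ _ Hlt HA) as <-.
    assert (HBt : B = L - t) by lra; subst B.
    apply (Hball (sigma t)) with (L1 := t) (L2 := L - t); auto; split.
    + destruct (Req_dec (sigma t) 0) as [E0|]; [|lra].
      rewrite E0 in Hlt.
      pose proof (curve_length_unique _ _ _ _ _ _ Hlt (curve_length_point n g 0)); lra.
    + destruct (Req_dec (sigma t) 1) as [E1|]; [|lra].
      rewrite E1 in HB.
      pose proof (curve_length_unique _ _ _ _ _ _ HB (curve_length_point n g 1)); lra.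
Qed.

Lemma cigar_length_le n phi D cJ d g L : (1 <= n)%nat -> phi_conditions phi -> 0 < cJ ->
  is_diam n D d -> 0 < L -> inRn n (g (L / 2)) ->
  ball_in n D (g (L / 2)) (psi phi (Rmin (L / 2) (L - L / 2)) / cJ) ->
  L <= Rmax 2 (cJ * d / phi 1).
Proof.
  intros Hn Hphi HcJ Hd HL Hg Hb; pose proof (phi1_pos phi Hphi).
  destruct (Rle_dec L 2); [eapply Rle_trans; [|apply Rmax_l]; assumption|].
  eapply Rle_trans; [|apply Rmax_r].
  apply ball_in_diam with (d := d) in Hb; auto.
  rewrite Rmin_left, psi_large in Hb by lra.
  replace (2 * (phi 1 * (L / 2) / cJ)) with (phi 1 * L / cJ) in Hb by (field; lra).
  apply Rmult_le_reg_r with (phi 1 / cJ); [apply Rdiv_lt_0_compat; assumption|].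
  replace (cJ * d / phi 1 * (phi 1 / cJ)) with d by (field; lra).
  replace (L * (phi 1 / cJ)) with (phi 1 * L / cJ) by (field; lra); assumption.
Qed.

(* An arc issuing from a point [x] at distance less than [e] from the complement
   reaches, after length [q], only points within [q + e] of the complement. *)
Lemma cigar_psi_le n phi D cJ d q : phi_conditions phi -> domain n D ->
  cigar_john n phi D cJ -> is_diam n D d -> 0 < q < d / 2 -> psi phi q <= cJ * q.
Proof.
  intros Hphi Hdom HC Hd Hq; pose proof (proj1 HC) as HcJ.
  pose proof (proj1 Hdom) as HDn.
  assert (psi phi q / cJ <= q).
  { apply Rle_plus_epsilon; intros eps Heps.
    set (eta := Rmin eps (d - 2 * q)).
    assert (Heta : 0 < eta <= eps /\ eta <= d - 2 * q).
    { unfold eta, Rmin; destruct (Rle_dec eps (d - 2 * q)); lra. }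
    destruct (diam_approx n D d (d - eta) Hd) as (x & y & Hx & Hy & Hxy); [lra|].
    assert (Hne : x <> y) by (intros ->; rewrite dist_refl in Hxy; lra).
    set (z := seg x y (- (eta / dist n x y))).
    assert (Hxz : dist n x z = eta).
    { unfold z; rewrite <- (seg_0 x y) at 1; rewrite dist_seg.
      rewrite Rminus_0_l, Ropp_involutive, Rabs_right; [field; lra|].
      left; apply Rdiv_lt_0_compat; lra. }
    assert (Hyz : dist n y z = dist n x y + eta).
    { unfold z; rewrite <- (seg_1 x y) at 1; rewrite dist_seg.
      assert (0 < eta / dist n x y) by (apply Rdiv_lt_0_compat; lra).
      rewrite Rabs_right by lra; field; lra. }
    assert (HzD : ~ D z).
    { intros Hz; pose proof (dist_le_diam n D d y z Hd Hy Hz); lra. }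
    destruct (cigar_arc n phi D cJ x y Hdom HC Hx Hy Hne)
      as (g & L & HL & HdL & Hg0 & _ & _ & Hlen & Hball).
    specialize (Hball q ltac:(lra)); rewrite Rmin_left in Hball by lra.
    apply Rnot_lt_le; intros Hlt; apply HzD, Hball.
    - apply inRn_seg; auto.
    - pose proof (dist_le_length n g 0 q _ ltac:(lra) (Hlen 0 q ltac:(lra) ltac:(lra) ltac:(lra))).
      pose proof (dist_triangle n (g q) (g 0) z) as Htri.
      rewrite (dist_sym n (g q) (g 0)), Hg0, Hxz in Htri; rewrite Hg0 in *; lra. }
  apply Rmult_le_reg_r with (/ cJ); [apply Rinv_0_lt_compat; assumption|].
  replace (cJ * q * / cJ) with q by (field; lra); assumption.
Qed.

Lemma psi_john_of_cigar n phi D cJ d :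
  (1 <= n)%nat -> phi_conditions phi -> domain n D -> cigar_john n phi D cJ -> is_diam n D d ->
  psi_john n phi D
    (cJ * phi 1 * (Rmax 2 (cJ * d / phi 1)) ^ 2 /
       psi phi (/ (2 * cJ) * psi phi (/ 4 * d)))
    (Rmax 2 (cJ * d / phi 1)).
Proof.
  intros Hn Hphi Hdom HC Hd.
  pose proof Hdom as (HDn & [w Hw] & Hop & _).
  pose proof (proj1 HC) as HcJ; pose proof (phi1_pos phi Hphi) as Hphi1.
  set (beta := Rmax 2 (cJ * d / phi 1)).
  assert (Hbeta : 2 <= beta) by apply Rmax_l.
  assert (Hd0 : 0 < d).
  { destruct (Hop w Hw) as (r & Hr & Hb).
    pose proof (ball_in_diam n D d w r Hn Hd (HDn w Hw) Hb); lra. }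
  set (rho := / (2 * cJ) * psi phi (/ 4 * d)).
  assert (Hrho_cJ : psi phi (/ 4 * d) = cJ * (2 * rho)) by (unfold rho; field; lra).
  assert (Hrho : 0 < rho).
  { unfold rho; apply Rmult_lt_0_compat; [apply Rinv_0_lt_compat; lra|apply psi_pos; auto; lra]. }
  assert (Hrho_d : rho <= d / 8).
  { pose proof (cigar_psi_le n phi D cJ d (/ 4 * d) Hphi Hdom HC Hd ltac:(lra)) as H.
    rewrite Hrho_cJ in H; apply Rmult_le_reg_l in H; lra. }
  pose proof (cigar_psi_le n phi D cJ d rho Hphi Hdom HC Hd ltac:(lra)) as Hpsi_rho.
  pose proof (psi_pos phi rho Hphi Hrho) as Hpsi_rho0.
  assert (Hcenter : d <= 2 * beta /\ exists x0, D x0 /\ ball_in n D x0 (2 * rho)).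
  { destruct (diam_approx n D d (d / 2) Hd) as (a & b & Ha & Hb & Hab); [lra|].
    assert (Hne : a <> b) by (intros ->; rewrite dist_refl in Hab; lra).
    destruct (cigar_arc n phi D cJ a b Hdom HC Ha Hb Hne)
      as (g & L & HL & HdL & _ & _ & HgD & _ & Hball).
    specialize (Hball (L / 2) ltac:(lra)); specialize (HgD (L / 2) ltac:(lra)).
    split.
    - pose proof (cigar_length_le n phi D cJ d g L Hn Hphi HcJ Hd HL (HDn _ HgD) Hball) as HLb.
      fold beta in HLb; lra.
    - exists (g (L / 2)); split; [assumption|].
      eapply ball_in_le; [|exact Hball].
      replace (2 * rho) with (psi phi (/ 4 * d) / cJ) by (rewrite Hrho_cJ; field; lra).
      apply Rmult_le_compat_r; [left; apply Rinv_0_lt_compat; assumption|].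
      apply psi_le; [assumption|lra|apply Rmin_glb; lra]. }
  destruct Hcenter as (Hd_beta & x0 & Hx0 & Hball0).
  assert (Hpsi_beta : forall t, 0 <= t <= beta -> psi phi t <= phi 1 * beta).
  { intros t Ht; rewrite <- psi_large by lra; apply psi_le; auto; lra. }
  set (alpha := cJ * phi 1 * beta ^ 2 / psi phi rho).
  assert (Halpha : 0 < alpha).
  { apply Rdiv_lt_0_compat; [|assumption].
    apply Rmult_lt_0_compat; [apply Rmult_lt_0_compat; assumption|apply pow_lt; lra]. }
  split; [assumption|]. split; [lra|]. exists x0; split; [assumption|]; intros x Hx.
  destruct (classic (x = x0)) as [->|Hne].
  { exists (fun _ => x0), 0.
    split; [lra|]. split; [|split; [|split; [|split; [|split; [|split]]]]]; auto; try lra.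
    - intros t Ht eps Heps; exists 1; split; [lra|]; intros; rewrite dist_refl; assumption.
    - intros s t Hs Hst Ht; assert (s = t) as -> by lra.
      rewrite Rminus_diag; apply curve_length_point.
    - intros t Ht z Hz; assert (t = 0) as -> by lra.
      rewrite psi_0 by assumption; unfold Rdiv; rewrite Rinv_0; lra. }
  destruct (cigar_arc n phi D cJ x x0 Hdom HC Hx Hx0 Hne)
    as (g & l & Hl & _ & Hg0 & Hgl & HgD & Hlen & Hball).
  assert (Hl_beta : l <= beta).
  { apply (cigar_length_le n phi D cJ d g l); auto; [apply HDn, HgD; lra|apply Hball; lra]. }
  assert (Hlip : lipschitz1 n g 0 l).
  { intros s t Hs Hst Ht; apply dist_le_length; auto. }
  exists g, l; split; [lra|]. split; [apply lipschitz1_cont; assumption|].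
  split; [assumption|]. split; [assumption|]. split; [assumption|].
  split; [assumption|]. split; [assumption|].
  intros t Ht z Hz; pose proof (dist_nonneg n (g t) z) as Hdz.
  assert (Hbound : forall p q, 0 <= p -> q / cJ <= dist n (g t) z ->
    p * l * psi phi rho <= phi 1 * beta ^ 2 * q -> p <= alpha / l * dist n (g t) z).
  { intros p q Hp Hq Hpq.
    apply Rle_trans with (alpha / l * (q / cJ)).
    - replace (alpha / l * (q / cJ)) with (phi 1 * beta ^ 2 * q / (l * psi phi rho))
        by (unfold alpha; field; repeat split; lra).
      assert (Hlp : 0 < l * psi phi rho) by (apply Rmult_lt_0_compat; lra).
      apply Rmult_le_reg_r with (l * psi phi rho); [assumption|].
      replace (phi 1 * beta ^ 2 * q / (l * psi phi rho) * (l * psi phi rho))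
        with (phi 1 * beta ^ 2 * q) by (field; split; lra); lra.
    - apply Rmult_le_compat_l; [left; apply Rdiv_lt_0_compat; lra|assumption]. }
  assert (Hpt : 0 <= psi phi t) by (apply psi_nonneg; auto; lra).
  destruct (Rle_dec t (l / 2)) as [Hhalf|Hhalf].
  - apply (Hbound _ (psi phi t)); [assumption| |].
    + destruct (Req_dec t 0) as [->|Ht0].
      { rewrite psi_0 by assumption; unfold Rdiv; rewrite Rmult_0_l; assumption. }
      specialize (Hball t ltac:(lra)); rewrite Rmin_left in Hball by lra.
      apply (ball_in_boundary n D); assumption.
    + assert (psi phi rho <= phi 1 * beta) by (apply Hpsi_beta; lra).
      assert (l * psi phi rho <= beta * (phi 1 * beta)) by (apply Rmult_le_compat; lra).
      nra.
  - assert (Hdist : psi phi rho / cJ <= dist n (g t) z).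
    { destruct (Rle_dec rho (l - t)) as [Hfar|Hnear].
      - specialize (Hball t ltac:(lra)); rewrite Rmin_right in Hball by lra.
        apply (ball_in_boundary n D); [|assumption].
        eapply ball_in_le; [|exact Hball].
        apply Rmult_le_compat_r; [left; apply Rinv_0_lt_compat; assumption|].
        apply psi_le; auto; lra.
      - apply Rle_trans with rho.
        + apply Rmult_le_reg_r with cJ; [assumption|].
          replace (psi phi rho / cJ * cJ) with (psi phi rho) by (field; lra); lra.
        + apply (ball_in_boundary n D); [|assumption].
          apply ball_in_shrink with x0 (2 * rho); [|assumption].
          rewrite <- Hgl, dist_sym; pose proof (Hlip t l); lra. }
    apply (Hbound _ (psi phi rho)); [assumption|assumption|].
    apply Rmult_le_compat_r; [lra|].
    pose proof (Hpsi_beta t ltac:(lra)).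
    assert (psi phi t * l <= (phi 1 * beta) * beta) by (apply Rmult_le_compat; lra).
    nra.
Qed.

Theorem theorem2p3 (phi : R -> R) (n : nat) (D : point -> Prop) :
  phi_conditions phi -> (2 <= n)%nat -> domain n D -> bounded_set n D ->
  ((exists alpha beta, psi_john n phi D alpha beta) ->
     exists cJ, cigar_john n phi D cJ) /\
  (forall cJ d, cigar_john n phi D cJ -> is_diam n D d ->
     psi_john n phi D
       (cJ * phi 1 * (Rmax 2 (cJ * d / phi 1)) ^ 2 /
          psi phi (/ (2 * cJ) * psi phi (/ 4 * d)))
       (Rmax 2 (cJ * d / phi 1))).
Proof.
  intros Hphi Hn Hdom _; split.
  - intros (alpha & beta & HJ); exact (cigar_of_psi_john n phi D alpha beta Hphi Hdom HJ).
  - intros cJ d HC Hd; apply psi_john_of_cigar; auto; lia.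
Qed.
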